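(* Let $q$ be a prime power and $k$ an integer such that $q\ge 4$ and $2\le k\le q-2$. If $u(x)=\lambda x^{q-2}+\delta x^{k-1}+f_{\le k-2}(x)$ with $\lambda\in\mathbf{F}_q^*$, $\delta\in\mathbf{F}_q$ and $f_{\le k-2}(x)\in\mathbf{F}_q[x]$ a polynomial of degree at most $k-2$, then the received word $(u(\mathbf{F}_q^* ),\delta)\in\mathbf{F}_q^{q}$ is a deep hole of the primitive projective Reed-Solomon code ${\rm PPRS}_q(\mathbf{F}_q^*,k)$.
   Context: $\mathbf{F}_q$ is the finite field with $q$ elements; $\mathbf{F}_q^*$ is its set of nonzero elements. Polynomials ''of degree at most $m$'' include the zero polynomial. Let $\alpha$ be a primitive element of $\mathbf{F}_q$ (a generator of $\mathbf{F}_q^*$). For $f(x)\in\mathbf{F}_q[x]$, put $f(\mathbf{F}_q^* ):=(f(1),f(\alpha),\ldots,f(\alpha^{q-2}))$ and let $c_{k-1}(f(x))$ be the coefficient of $x^{k-1}$ in $f(x)$. The primitive projective Reed-Solomon code is ${\rm PPRS}_q(\mathbf{F}_q^*,k):=\{(f(\mathbf{F}_q^* ),c_{k-1}(f(x)))\in\mathbf{F}_q^{q} : f(x)\in\mathbf{F}_q[x],\ \deg f(x)\le k-1\}$. For a code $C\subseteq \mathbf{F}_q^{N}$, $d(\cdot,\cdot)$ denotes Hamming distance (the number of coordinates in which two words differ), $d(w,C):=\min_{v\in C} d(w,v)$ is the error distance of $w\in\mathbf{F}_q^N$, and $\rho(C):=\max\{d(w,C): w\in\mathbf{F}_q^N\}$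 is the covering radius. A word $w\in\mathbf{F}_q^{N}\setminus C$ is a deep hole of $C$ if $d(w,C)=\rho(C)$. *)

(* Defs.v *)
From HB Require Import structures.
From mathcomp Require Import all_boot all_order all_fingroup all_algebra.
From mathcomp Require Import all_solvable.

Set Implicit Arguments.
Unset Strict Implicit.
Unset Printing Implicit Defensive.

Import GRing.Theory.
Local Open Scope ring_scope.

Definition hamming_dist (F : finFieldType) (N : nat) (v w : 'rV[F]_N) : nat :=
  #|[set i | v 0 i != w 0 i]|.

(* The neutral value N is an upper bound of every Hamming distance, so this is
   the true minimum as soon as C is nonempty. *)
Definition error_dist (F : finFieldType) (N : nat) (w : 'rV[F]_N)
    (C : {set 'rV[F]_N}) : nat :=
  \big[minn/N]_(v in C) hamming_dist w v.

Definition covering_radius (F : finFieldType) (N : nat)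
    (C : {set 'rV[F]_N}) : nat :=
  (\max_(w : 'rV[F]_N) error_dist w C)%N.

Definition deep_hole (F : finFieldType) (N : nat) (C : {set 'rV[F]_N})
    (w : 'rV[F]_N) : Prop :=
  w \notin C /\ error_dist w C = covering_radius C.

Definition primitive_element (F : finFieldType) (alpha : {unit F}) : Prop :=
  generator [set: {unit F}] alpha.

Definition eval_units (F : finFieldType) (alpha : {unit F}) (f : {poly F}) :
    'rV[F]_(#|F|.-1) :=
  \row_(i < #|F|.-1) f.[FinRing.uval alpha ^+ i].

(* Words of length q are written with q = (q - 1) + 1, the summand 1 being the
   extra projective coordinate. *)
Definition ext_word (F : finFieldType) (alpha : {unit F}) (f : {poly F})
    (c : F) : 'rV[F]_(#|F|.-1 + 1) :=
  row_mx (eval_units alpha f) c%:M.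

(* {poly_k F} consists of the polynomials of size <= k, i.e. degree <= k - 1. *)
Definition PPRS (F : finFieldType) (alpha : {unit F}) (k : nat) :
    {set 'rV[F]_(#|F|.-1 + 1)} :=
  [set ext_word alpha f (f : {poly F})`_k.-1 | f : {poly_k F}].

(* Main.v *)
Require Import Defs.
From HB Require Import structures.
From mathcomp Require Import all_boot all_order all_fingroup all_algebra.
From mathcomp Require Import all_solvable.
Import GRing.Theory.
Local Open Scope ring_scope.

(** Write q for the order of F.  Every word is within distance q - k of the
    code, because a polynomial of degree at most k - 1 can be interpolated
    through k of the q - 1 evaluation points ([error_dist_PPRS_le]).  So it
    suffices that no codeword agrees with the given word in more than k places.

    On nonzero points x^(q-2) is 1/x, so on these points the difference between
    u and a polynomial v of degree at most k - 1 is lambda / x + h, where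
    h = delta x^(k-1) + f - v.  It vanishes exactly at the roots of
    lambda + x h, which is a nonzero polynomial because its constant term is
    lambda ([mulX_inverse_horner]).  In general it has degree at most k, hence
    at most k roots.  If the words also agree in the projective coordinate, the
    terms of degree k - 1 in h cancel: the degree, and hence the number of
    agreements among the evaluation points, is at most k - 1, which compensates
    for the additional agreement ([inverse_word_agreement]).  Up to
    scaling of coordinates, the substitution x -> 1/x turns this into the fact
    that x^k is a deep hole of the Reed-Solomon code of dimension k on all
    of F. *)

Lemma error_dist_le (F : finFieldType) (N : nat) (w v : 'rV[F]_N)
    (C : {set 'rV[F]_N}) :
  v \in C -> (error_dist w C <= hamming_dist w v)%N.
Proof.
by move=> vC; apply: (@Order.TotalTheory.bigmin_le_cond _ nat _ N v).
Qed.

Lemma le_error_dist (F : finFieldType) (N d : nat) (w : 'rV[F]_N)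
    (C : {set 'rV[F]_N}) :
    (d <= N)%N -> (forall v, v \in C -> (d <= hamming_dist w v)%N) ->
  (d <= error_dist w C)%N.
Proof.
move=> dN dC; rewrite /error_dist.
by elim/big_ind: _ => // m n dm dn; rewrite leq_min dm.
Qed.

Lemma deep_hole_of_bounds (F : finFieldType) (N d : nat) (w : 'rV[F]_N)
    (C : {set 'rV[F]_N}) :
    (0 < d)%N -> (forall w', error_dist w' C <= d)%N ->
    (d <= error_dist w C)%N ->
  deep_hole C w.
Proof.
move=> d_gt0 Cd dw; split.
  apply: contraTN (leq_trans d_gt0 dw) => wC; rewrite -leqNgt.
  rewrite (leq_trans (error_dist_le _ _ _ _ _ wC)) // leqn0 cards_eq0.
  by apply/eqP/setP=> i; rewrite !inE eqxx.
apply/eqP; rewrite eqn_leq (leq_bigmax w) /=.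
by apply/bigmax_leqP=> w' _; apply: leq_trans dw.
Qed.

Lemma hamming_dist_agree (F : finFieldType) (N : nat) (v w : 'rV[F]_N) :
  hamming_dist v w = (N - #|[set i | v 0%R i == w 0%R i]|)%N.
Proof.
rewrite /hamming_dist cardsCs card_ord; congr (N - #|pred_of_set _|)%N.
by apply/setP=> i; rewrite !inE negbK.
Qed.

(** Newton's scheme: adding a multiple of the product of the X - x_i over the
    points already treated corrects the value at the next point without
    changing the earlier ones. *)
Lemma interpolation (K : fieldType) (n : nat) (x y : nat -> K) :
    {in gtn n &, injective x} ->
  exists2 p : {poly K},
    (size p <= n)%N & forall i, (i < n)%N -> p.[x i] = y i.
Proof.
elim: n => [|n IHn] x_inj; first by exists 0; rewrite ?size_poly0.
have [|p sz_p pE] := IHn.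
  by move=> i j ltin ltjn; apply: x_inj; apply: ltnW.
pose r := \prod_(i < n) ('X - (x i)%:P).
have rn0 : r.[x n] != 0.
  rewrite horner_prod; apply/prodf_neq0=> i _.
  rewrite hornerXsubC subr_eq0; apply/eqP=> /x_inj eq_ni.
  have := ltn_ord i; rewrite -eq_ni ?ltnn ?inE //.
  exact: ltnW (ltn_ord i).
exists (p + ((y n - p.[x n]) / r.[x n]) *: r) => [|i].
  rewrite (leq_trans (size_polyD _ _)) // geq_max (leqW sz_p) /=.
  rewrite (leq_trans (size_scale_leq _ _)) //.
  rewrite /r -(big_mkord xpredT (fun i => 'X - (x i)%:P)) size_prod_XsubC.
  by rewrite size_iota subn0.
rewrite ltnS leq_eqVlt hornerD hornerZ => /predU1P[->|ltin].
  by rewrite divfK // addrC subrK.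
rewrite pE // [r.[x i]]horner_prod (bigD1 (Ordinal ltin)) //=.
by rewrite hornerXsubC subrr mul0r mulr0 addr0.
Qed.

Lemma card_root_lt_size (R : idomainType) (I : finType) (x : I -> R)
    (p : {poly R}) :
  injective x -> p != 0 -> (#|[set i | root p (x i)]| < size p)%N.
Proof.
move=> x_inj p0; rewrite cardE -(size_map x); apply: max_poly_roots => //.
  by apply/allP=> _ /mapP[i + ->]; rewrite mem_enum inE.
by rewrite map_inj_uniq ?enum_uniq.
Qed.

Section PrimitivePoints.

Variables (F : finFieldType) (alpha : {unit F}).
Hypothesis halpha : primitive_element alpha.

Let a := FinRing.uval alpha.

Lemma order_primitive : #[alpha]%g = #|F|.-1.
Proof. by rewrite /order -(eqP halpha) card_finField_unit. Qed.

Lemma primitive_pow_inj : {in gtn #|F|.-1 &, injective (fun i => a ^+ i)}.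
Proof.
move=> i j lti ltj /=; rewrite /a -!FinRing.val_unitX => /val_inj/eqP.
by rewrite eq_expg_mod_order order_primitive !modn_small // => /eqP.
Qed.

Lemma ext_word_agree (u v : {poly F}) (c d : F) :
  #|[set i | ext_word alpha u c 0 i == ext_word alpha v d 0 i]| =
  (#|[set i : 'I_#|F|.-1 | root (u - v)%R (a ^+ i)]| + (c == d))%N.
Proof.
rewrite -!sum1_card big_split_ord /=; congr addn.
  apply: eq_bigl => i; rewrite !inE !row_mxEl !mxE.
  by rewrite /root hornerD hornerN subr_eq0.
rewrite big_mkcond big_ord1 !inE !row_mxEr !mxE eqxx !mulr1n.
by case: eqP.
Qed.

(** By interpolation, some codeword agrees with w at the first k evaluation
    points. *)
Lemma error_dist_PPRS_le (k : nat) (w : 'rV[F]_(#|F|.-1 + 1)) :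
  (k <= #|F|.-1)%N -> (error_dist w (PPRS alpha k) <= #|F|.-1 + 1 - k)%N.
Proof.
move=> le_k.
have x_inj : {in gtn k &, injective (fun i => a ^+ i)}.
  by move=> i j lti ltj; apply: primitive_pow_inj; apply: leq_trans le_k.
have le_kN : (k <= #|F|.-1 + 1)%N by rewrite addn1 leqW.
(* Only indices i < k matter, so the default value 0 is never used. *)
pose y i := if insub i is Some j then w 0 (lshift 1 j) else 0.
have [p sz_p pE] := interpolation _ _ _ y x_inj.
have vC : ext_word alpha p p`_k.-1 \in PPRS alpha k.
  by apply/imsetP; exists (npolyp k p); rewrite ?npolypK.
apply: leq_trans (error_dist_le _ _ _ _ _ vC) _.
rewrite hamming_dist_agree leq_sub2l //.
have widen_inj : injective (widen_ord le_kN).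
  by move=> i j /(congr1 val) /= /val_inj.
rewrite -[leqLHS]card_ord -(card_imset _ widen_inj).
apply/subset_leq_card/subsetP => _ /imsetP[i _ ->]; rewrite inE.
have lti : (i < #|F|.-1)%N by apply: leq_trans le_k.
have -> : widen_ord le_kN i = lshift 1 (Ordinal lti) by apply: val_inj.
by rewrite row_mxEl mxE /= pE // /y insubT.
Qed.

(** The monomial of degree q - 2 is inversion on nonzero points, so multiplying
    by the point clears the pole. *)
Lemma mulX_inverse_horner (lambda : F) (h : {poly F}) (i : nat) :
    (2 <= #|F|)%N ->
  a ^+ i * (lambda *: 'X^(#|F| - 2) + h).[a ^+ i] =
  (lambda%:P + 'X * h).[a ^+ i].
Proof.
move=> hq; rewrite !hornerE mulrDr; congr (_ + _).
rewrite mulrCA -exprS -exprM mulnC exprM.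
have -> : (#|F| - 2).+1 = #|F|.-1 by case: #|F| hq => [|[|n]] //; rewrite subn2.
have -> : a ^+ #|F|.-1 = 1.
  by rewrite /a -FinRing.val_unitX -order_primitive expg_order.
by rewrite expr1n mulr1.
Qed.

(** The polynomial lambda + x h, with h = delta x^(k-1) + f - v, cuts out the
    agreements at the evaluation points; its degree drops below k when the
    projective coordinates delta and v_(k-1) agree. *)
Lemma inverse_word_agreement (k : nat) (lambda delta : F) (f v : {poly F}) :
    (2 <= #|F|)%N -> (0 < k)%N -> lambda != 0 ->
    (size f <= k.-1)%N -> (size v <= k)%N ->
  (#|[set i | ext_word alpha
        (lambda *: 'X^(#|F| - 2) + delta *: 'X^(k.-1) + f) delta 0 i
        == ext_word alpha v v`_k.-1 0 i]%R| <= k)%N.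
Proof.
case: k => // k hq _ lambda0 /= szf szv; rewrite ext_word_agree.
pose h := delta *: 'X^k + f - v.
have p0 : lambda%:P + 'X * h != 0.
  apply: contraNneq lambda0 => /(congr1 (fun r : {poly F} => r`_0)).
  by rewrite coefD coefC coefXM coef0 addr0 => ->.
have szh : (size h <= k.+1 - (delta == v`_k)%R)%N.
  apply/leq_sizeP=> j.
  rewrite /h coefB coefD coefZ coefXn; have [<-|neq_jk] := eqVneq k j.
    rewrite mulr1 [f`_k]nth_default // addr0.
    by case: eqP => [<-|_]; rewrite ?subrr // subn0 ltnn.
  move=> le_j; have le_kj : (k <= j)%N.
    by apply: leq_trans le_j; case: (delta == _); rewrite ?subn1 ?subn0.
  rewrite mulr0 add0r [f`_j]nth_default ?(leq_trans szf) //.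
  by rewrite nth_default ?subr0 // (leq_trans szv) // ltn_neqAle neq_jk.
have szp : (size (lambda%:P + 'X * h)%R <= (size h).+1)%N.
  rewrite (leq_trans (size_polyD _ _)) // geq_max.
  rewrite (leq_trans (size_polyC_leq1 _)) //=.
  by rewrite (leq_trans (size_polyMleq _ _)) // size_polyX.
have x_inj : injective (fun i : 'I_#|F|.-1 => a ^+ i).
  by move=> i j /primitive_pow_inj eq_ij; apply/val_inj/eq_ij; rewrite inE.
rewrite addnC -leq_subRL; last by case: (delta == _).
apply: leq_trans szh; rewrite -ltnS; apply: leq_trans szp.
apply: leq_trans (card_root_lt_size _ _ _ _ x_inj p0); rewrite ltnS.
apply/subset_leq_card/subsetP=> i; rewrite !inE /root -!addrA => /eqP u0.
by rewrite -mulX_inverse_horner // /h -!addrA u0 mulr0.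
Qed.

End PrimitivePoints.

Theorem theorem1p7 (F : finFieldType) (alpha : {unit F}) (k : nat)
    (lambda delta : F) (f u : {poly F})
    (halpha : primitive_element alpha)
    (hq : (4 <= #|F|)%N) (hk2 : (2 <= k)%N) (hkq : (k <= #|F| - 2)%N)
    (hlambda : lambda != 0)
    (hf : (size f <= k.-1)%N) (* deg f <= k - 2 *)
    (hu : u = lambda *: 'X^(#|F| - 2) + delta *: 'X^(k - 1) + f) :
  deep_hole (PPRS alpha k) (ext_word alpha u delta).
Proof.
have le_k : (k <= #|F|.-1)%N.
  by rewrite (leq_trans hkq) // -subn1 leq_sub2l.
apply: (@deep_hole_of_bounds _ _ (#|F|.-1 + 1 - k)).
- by rewrite subn_gt0 addn1 ltnS.
- by move=> w; apply: error_dist_PPRS_le.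
apply: le_error_dist => [|_ /imsetP[v _ ->]]; first exact: leq_subr.
rewrite hamming_dist_agree leq_sub2l // hu subn1.
apply: inverse_word_agreement => //.
- exact: leq_trans hq.
- exact: ltnW.
Qed.
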